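(* $h(n) = (n-1)/2$ for each of the following values of $n$: $n = 19, 23, 27, 71, 103, 127, 271, 571, 631, 883, 991, 1039, 1171, 1279, 1579, 1723$.
   Context: $A_n$ is the alternating group of degree $n$, acting on $\mathbb{Z}_n = \mathbb{Z}/n\mathbb{Z} = \{0,1,\ldots,n-1\}$. Permutations act on the right (the image of $x$ under $\pi$ is $x^\pi$) and are composed from left to right. For $n$ odd, let $c = (0,1,\ldots,n-1) \in A_n$, i.e. $x^c = x+1$. For $\pi \in A_n$, $[\pi] = \langle c\rangle \pi$ is the coset of $\langle c \rangle$ containing $\pi$; its elements are the permutations $c^j\pi$ (first $c^j$, then $\pi$). Define $h(\pi)$ to be the minimum number of 3-cycles in an expression of $\pi$ as a product of (not necessarily disjoint) 3-cycles in $A_n$, with $h(\mathrm{id}) = 0$. Define $h([\pi]) = \min_{\sigma \in [\pi]} h(\sigma) = \min_{0 \le j \le n-1} h(c^j\pi)$ and $h(n) = \max_{\pi \in A_n} h([\pi])$. *)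

(* Defs.v *)
From mathcomp Require Import all_boot all_fingroup.
From mathcomp Require Import alt.

Set Implicit Arguments.
Unset Strict Implicit.
Unset Printing Implicit Defensive.

Local Open Scope group_scope.

(* Z/nZ is represented by 'I_n, and ordS is the successor modulo n.
   MathComp composes permutations from left to right: (s * t) x = t (s x). *)
Definition shift (n : nat) : 'S_n := perm (@ordS_inj n).

Definition is_3cycle (n : nat) (s : 'S_n) : bool :=
  [exists x, exists y, exists z,
    [&& uniq [:: x; y; z], s x == y, s y == z, s z == x
      & [forall w, (w \notin [:: x; y; z]) ==> (s w == w)]]].

Definition is_prod_3cycles (n : nat) (s : 'S_n) (k : nat) : bool :=
  [exists ts : k.-tuple 'S_n,
    all (@is_3cycle n) ts && (s == \prod_(t <- ts) t)].

Lemma is_3cycle_tperm (n : nat) (x y z : 'I_n) :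
  x != y -> x != z -> y != z -> is_3cycle (tperm x y * tperm x z).
Proof.
move=> xy xz yz; apply/existsP; exists x; apply/existsP; exists y.
apply/existsP; exists z; rewrite /= !inE negb_or xy xz yz /= !permM.
rewrite tpermL tpermR tpermL (tpermD xy) 1?eq_sym //.
rewrite (tpermD xz yz) tpermR !eqxx /=.
apply/forallP=> w; apply/implyP; rewrite !inE !negb_or => /and3P[wx wy wz].
by rewrite permM !tpermD 1?eq_sym.
Qed.

Lemma Alt_prod_3cycles (n : nat) (s : 'S_n) :
  s \in 'Alt_('I_n) -> exists k, is_prod_3cycles s k.
Proof.
rewrite Alt_even => s_even.
suff /gen_prodgP[k [f f3 ->]] : s \in <<[set t : 'S_n | is_3cycle t]>>.
  exists k; apply/existsP; exists [tuple f i | i < k]; apply/andP; split.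
    by apply/allP=> t /mapP[i _ ->]; have:= f3 i; rewrite inE.
  by rewrite big_tuple; apply/eqP/eq_bigr=> i _; rewrite tnth_mktuple.
have gen2 (x y z : 'I_n) : x != y -> x != z ->
  tperm x y * tperm x z \in <<[set t : 'S_n | is_3cycle t]>>.
  move=> xy xz; have [<-|yz] := eqVneq y z; first by rewrite tperm2 group1.
  by apply: mem_gen; rewrite inE is_3cycle_tperm.
have [ts Es dts] := prod_tpermP s; move: s_even.
rewrite {s}Es odd_perm_prod // => ev.
have [m] := ubnP (size ts); elim: m ts dts ev => // m IH.
case=> [|[a b] [|[c d] ts]] //=; first by rewrite big_nil group1.
rewrite /dpair /= => /and3P[ab cd dts]; rewrite negbK => ev le_m.
rewrite !big_cons /= mulgA groupM //; last first.
  by apply: IH => //; rewrite ltnS in le_m; apply: leq_trans le_m; rewrite leqnSn.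
have [ac|ac] := eqVneq a c; first by rewrite -ac in cd *; apply: gen2.
have -> : tperm a b * tperm c d =
          (tperm a b * tperm a c) * (tperm c a * tperm c d).
  by rewrite (tpermC c a) mulgA -(mulgA (tperm a b)) tperm2 mulg1.
by rewrite groupM // gen2 // eq_sym.
Qed.

(* The value 0 on odd permutations is a dummy one. *)
Definition h (n : nat) (s : 'S_n) : nat :=
  if @idP (s \in 'Alt_('I_n)) is ReflectT sA then ex_minn (Alt_prod_3cycles sA)
  else 0.

(* For n odd, shift n is even, so the coset of pi \in 'Alt_('I_n) stays inside
   'Alt_('I_n), and h takes no dummy value on it. *)
Definition coset_shift (n : nat) (pi : 'S_n) : {set 'S_n} := <[shift n]> :* pi.

(* Since pi belongs to its own coset, starting the minimum at h pi does not
   change it. *)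
Definition h_coset (n : nat) (pi : 'S_n) : nat :=
  \big[minn/h pi]_(s in coset_shift pi) h s.

Definition h_max (n : nat) : nat := \max_(pi in 'Alt_('I_n)) h_coset pi.

(* Main.v *)
(** An even permutation moving at most [n] points is a product of at most
    [n./2] 3-cycles: a cycle of length at least 3 loses two points to one
    3-cycle, and two transpositions are undone by two 3-cycles. Conversely, the
    [k] 3-cycles of a product glue the [n] points into blocks, at least
    [n - 2 k] of which are odd, and each odd block contains an odd cycle of the
    product. So [h s = (n - 1) / 2] when [s] has a single odd cycle.

    It remains to exhibit, for each [n], an even [pi] such that every [c ^ j pi]
    has a single odd cycle. For [n] prime with primitive root [w], take
    [pi 0 = 0] and [pi x = a_i x] on the coset [w ^ i H] of the subgroup [H]
    generated by [w ^ e]; as [pi] commutes with multiplication by [g = w ^ e],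
    [c ^ (g j) pi] is conjugate to [c ^ j pi], so that only [j = 0] and
    [j = w ^ i] with [i < e] are left to compute. The [a_i] come from a computer
    search, in which [e = 3] suffices except for 71 ([e = 5]) and 23
    ([e = 11]). For [n = 27] the search is over the [pi] commuting with [-1]. *)

From Stdlib Require Import NArith FMapPositive.
Require Import Defs.
From mathcomp Require Import all_boot all_fingroup.
From mathcomp Require Import alt zify.

Set Implicit Arguments.
Unset Strict Implicit.
Unset Printing Implicit Defensive.

Local Open Scope group_scope.

(** * Products of 3-cycles and the length [h] *)

Lemma is_prod_3cyclesP n (s : 'S_n) k :
  reflect (exists ts : seq 'S_n,
             [/\ size ts = k, all (@is_3cycle n) ts & s = \prod_(t <- ts) t])
          (is_prod_3cycles s k).
Proof.
apply: (iffP existsP) => [[ts /andP[h3 /eqP->]]|[ts [sz h3 ->]]].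
  by exists ts; rewrite size_tuple.
by move/eqP: sz => sz; exists (Tuple sz); rewrite h3 eqxx.
Qed.

Lemma is_prod_3cycles0 n : is_prod_3cycles (1 : 'S_n) 0.
Proof. by apply/is_prod_3cyclesP; exists [::]; rewrite big_nil. Qed.

Lemma is_prod_3cyclesS n (t s : 'S_n) k :
  is_3cycle t -> is_prod_3cycles s k -> is_prod_3cycles (t * s) k.+1.
Proof.
move=> t3 /is_prod_3cyclesP[ts [sz h3 ->]]; apply/is_prod_3cyclesP.
by exists (t :: ts); rewrite /= sz t3 h3 big_cons.
Qed.

Lemma h_le n (s : 'S_n) k :
  s \in 'Alt_('I_n) -> is_prod_3cycles s k -> h s <= k.
Proof.
rewrite /h => sA sk; case: {-}_ / idP => // sA'.
by case: ex_minnP => m _; apply.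
Qed.

Lemma is_prod_3cycles_h n (s : 'S_n) :
  s \in 'Alt_('I_n) -> is_prod_3cycles s (h s).
Proof. by rewrite /h => sA; case: {-}_ / idP => // sA'; case: ex_minnP. Qed.

(** * Upper bound on [h]: shrinking the support *)

Definition supp n (s : 'S_n) := [set x | s x != x].

Lemma tperm_mul_fix n (x y z w : 'I_n) :
  w \notin [:: x; y; z] -> (tperm x y * tperm x z) w = w.
Proof.
rewrite !inE !negb_or => /and3P[wx wy wz].
by rewrite permM !tpermD // eq_sym.
Qed.

(* [tperm y x * tperm y z] sends [x] to [z], [z] to [y] and [y] to [x], so
   composing it with [s] fixes both [y] and [z]. *)
Lemma card_supp_3cycle n (s : 'S_n) (x : 'I_n) :
  let y := s x in let z := s y in
  x != y -> x != z ->
  (#|supp (tperm y x * tperm y z * s)|).+2 <= #|supp s|.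
Proof.
move=> y z xy xz; have yz : y != z by rewrite /z /y (inj_eq perm_inj).
set t := tperm y x * tperm y z.
have sub : supp (t * s) \subset supp s :\ y :\ z.
  apply/subsetP=> w; rewrite !inE permM => tsw.
  have [wt|wt] := boolP (w \in [:: y; x; z]); last first.
    rewrite tperm_mul_fix // in tsw; rewrite tsw !andbT.
    by move: wt; rewrite !inE !negb_or => /and3P[-> _ ->].
  move: wt tsw; rewrite !inE => /or3P[]/eqP->.
  - by rewrite permM tpermL tpermD ?eqxx // eq_sym.
  - by move=> _; apply/and3P; split=> //; rewrite -[s x]/y eq_sym.
  by rewrite permM [tperm y x z]tpermD ?tpermR ?eqxx.
have zs : z \in supp s :\ y by rewrite !inE eq_sym yz (inj_eq perm_inj) eq_sym.
have ys : y \in supp s by rewrite inE eq_sym.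
rewrite (cardsD1 y (supp s)) ys (cardsD1 z (_ :\ _)) zs !ltnS.
exact: subset_leq_card.
Qed.

(** Here [s] exchanges [x] with [y] and [w] with [z]; cancelling both exchanges fixes these four
    points and moves no new one. *)
Lemma card_supp_tperm2 n (s : 'S_n) (x w : 'I_n) :
  let y := s x in let z := s w in
  s y = x -> s z = w -> uniq [:: x; y; w; z] ->
  #|supp (tperm x y * tperm w z * s)| + 4 <= #|supp s|.
Proof.
move=> y z yx zw u4.
have -> : 4 = #|[set v in [:: x; y; w; z]]|.
  by rewrite cardsE; move/card_uniqP: u4 => ->.
move: u4; rewrite /= !inE !negb_or -!andbA andbT.
case/and5P=> xy xw xz yw /andP[yz wz].
have sub : supp (tperm x y * tperm w z * s) \subset
    supp s :\: [set v in [:: x; y; w; z]].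
  apply/subsetP=> v; rewrite !inE !permM => tsv.
  have [/eqP e|vx] := boolP (v == x).
    by move: tsv; rewrite e tpermL tpermD 1?eq_sym // yx eqxx.
  have [/eqP e|vy] := boolP (v == y).
    by move: tsv; rewrite e tpermR tpermD 1?eq_sym // eqxx.
  have [/eqP e|vw] := boolP (v == w).
    by move: tsv; rewrite e [tperm x y w]tpermD // tpermL zw eqxx.
  have [/eqP e|vz] := boolP (v == z).
    by move: tsv; rewrite e [tperm x y z]tpermD // tpermR eqxx.
  by move: tsv; rewrite !tpermD // eq_sym.
have sub4 : [set v in [:: x; y; w; z]] \subset supp s.
  apply/subsetP=> v; rewrite !inE => /or4P[]/eqP->; rewrite -/y -/z ?yx ?zw //.
  - by rewrite eq_sym.
  - by rewrite eq_sym.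
rewrite -(cardsID [set v in [:: x; y; w; z]] (supp s)) addnC leq_add //.
  by rewrite (setIidPr sub4).
exact: subset_leq_card.
Qed.

Lemma prod_3cycles_supp n (s : 'S_n) :
  ~~ odd_perm s -> exists2 k, k.*2 <= #|supp s| & is_prod_3cycles s k.
Proof.
have [m] := ubnP #|supp s|; elim: m s => // m IH s; rewrite ltnS => lt_m ev.
have [/existsP[x yx]|/existsPn invol] := boolP [exists x, s (s x) != x].
  (* The cycle of [x] has length at least 3: strip one 3-cycle from it. *)
  set y := s x in yx.
  have xy : x != y.
    by apply: contraNneq yx => e; rewrite -e -/y -e.
  have := card_supp_3cycle xy; rewrite eq_sym => /(_ yx).
  set t := tperm y x * tperm y (s y) => le_t.
  have yz : y != s y by rewrite (inj_eq perm_inj).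
  have [||k le_k k3] := IH (t * s).
  - by rewrite (leq_trans _ lt_m) // (leq_trans _ le_t).
  - by rewrite !odd_permM !odd_tperm yz eq_sym xy (negPf ev).
  exists k.+1; first by rewrite doubleS (leq_trans _ le_t) // !ltnS.
  have -> : s = tperm y (s y) * tperm y x * (t * s).
    by rewrite /t -!mulgA (mulgA (tperm y x)) tperm2 mul1g mulgA tperm2 mul1g.
  by apply: is_prod_3cyclesS => //; apply: is_3cycle_tperm; rewrite // eq_sym.
(* From here on [s] is an involution. *)
have [s0|[x]] := set_0Vmem (supp s).
  exists 0 => //; suff -> : s = 1 by apply: is_prod_3cycles0.
  apply/permP=> x; rewrite perm1; apply/eqP/negbNE.
  by have := in_set0 x; rewrite -s0 inE => ->.
rewrite inE => sx; set y := s x in sx.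
have yx : s y = x by apply/eqP/negbNE/invol.
(* Being even, [s] is not the single transposition of [x] and [y], so it moves a third point. *)
have [w /and3P[wx wy sw]] : exists w, [&& w != x, w != y & s w != w].
  apply/existsP; apply: contraNT ev; rewrite negb_exists => /forallP fixw.
  suff -> : s = tperm x y by rewrite odd_tperm eq_sym.
  apply/permP=> w; case: tpermP => [->//|->//|/eqP wx /eqP wy].
  by apply/eqP; have := fixw w; rewrite wx wy negbK.
set z := s w in sw.
have zw : s z = w by apply/eqP/negbNE/invol.
have zx : z != x by rewrite -yx (inj_eq perm_inj).
have zy : z != y by rewrite (inj_eq perm_inj).
have u4 : uniq [:: x; y; w; z].
  rewrite /= !inE !negb_or (eq_sym x) sx (eq_sym x) wx (eq_sym x) zx.
  by rewrite (eq_sym y) wy (eq_sym y) zy eq_sym sw.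
have := card_supp_tperm2 yx zw u4.
set t := tperm x y * tperm w z => le_t.
have [||k le_k k3] := IH (t * s).
- by rewrite (leq_trans _ lt_m) // (leq_trans _ le_t) // addnS ltnS leq_addr.
- by rewrite !odd_permM !odd_tperm (eq_sym x) sx (eq_sym w) sw (negPf ev).
exists k.+2; first by rewrite !doubleS (leq_trans _ le_t) // addn4 !ltnS.
(* The inner [tperm x w] cancels, so the two 3-cycles multiply to [tperm x y * tperm w z], which is
   its own inverse and undoes [t]. *)
have -> : s = tperm x y * tperm x w * (tperm w x * tperm w z * (t * s)).
  have commt : tperm x y * tperm w z = tperm w z * tperm x y.
    apply/commgP/conjg_fixP.
    by rewrite tpermJ !tpermD // eq_sym.
  rewrite /t (tpermC w x) !mulgA -(mulgA _ (tperm x w) (tperm x w)) tperm2.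
  rewrite mulg1 commt -(mulgA _ (tperm x y) (tperm x y)) tperm2 mulg1.
  by rewrite tperm2 mul1g.
have wxz3 : is_3cycle (tperm w x * tperm w z).
  by apply: is_3cycle_tperm; rewrite // eq_sym.
have xyw3 : is_3cycle (tperm x y * tperm x w).
  by apply: is_3cycle_tperm; rewrite // eq_sym.
by do 2!apply: is_prod_3cyclesS => //.
Qed.

Lemma h_le_half n (s : 'S_n) : s \in 'Alt_('I_n) -> h s <= n./2.
Proof.
move=> sA; have := sA; rewrite Alt_even => /prod_3cycles_supp[k le_k k3].
apply: leq_trans (h_le sA k3) _; rewrite -[k]doubleK half_leq //.
by apply: leq_trans le_k _; rewrite -[leqRHS]card_ord max_card.
Qed.

(** * Lower bound on [h]: counting odd blocks *)

Definition odd_fibres (T L : finType) (f : T -> L) :=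
  \sum_l odd #|f @^-1: [set l]|.

Lemma sum_odd (I : finType) (P : pred I) (F : I -> nat) :
  odd (\sum_(i | P i) odd (F i)) = odd (\sum_(i | P i) F i).
Proof.
apply: (big_rec2 (fun a b => odd a = odd b)) => // i a b _ IH.
by rewrite !oddD IH oddb.
Qed.

Lemma card_preimset_sum (T L : finType) (f : T -> L) (B : {set L}) :
  #|f @^-1: B| = \sum_(l in B) #|f @^-1: [set l]|.
Proof.
rewrite -sum1_card (partition_big f (mem B)) => [|x]; last by rewrite inE.
apply: eq_bigr => l lB; rewrite -sum1_card; apply: eq_bigl => x.
by rewrite !inE; case: eqP => [->|]; rewrite ?andbF // andbT.
Qed.

(* Gluing at most three fibres loses at most two odd ones: the number of odd
   fibres glued has the parity of the size of their union. *)
Lemma odd_fibres_merge (T L : finType) (f : T -> L) (B : {set L}) (b : L) :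
  b \in B -> #|B| <= 3 ->
  odd_fibres f <= odd_fibres (fun x => if f x \in B then b else f x) + 2.
Proof.
(* Labels outside [B] keep their fibres; those in [B] are compared with the one fibre that replaces
   them. *)
move=> bB B3; set f' := fun x => _; rewrite /odd_fibres.
rewrite (bigID (mem B)) [in leqRHS](bigID (mem B)) /= addnAC leq_add //.
  have -> : \sum_(l in B) odd #|f' @^-1: [set l]| =
            odd (\sum_(l in B) #|f @^-1: [set l]|) :> nat.
    rewrite (bigD1 b) //= big1 => [|l /andP[lB lb]].
      rewrite addn0; congr (nat_of_bool (odd _)).
      rewrite -card_preimset_sum; apply: eq_card => x; rewrite !inE /f'.
      by case: ifP => [_|]; rewrite ?eqxx //; apply: contraFF => /eqP->.
    rewrite (_ : _ @^-1: _ = set0) ?cards0 //; apply/setP=> x; rewrite !inE.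
    rewrite /f'; case: ifP => [_|]; first by rewrite eq_sym (negPf lb).
    by apply: contraFF => /eqP->.
  rewrite -sum_odd; set N := \sum_(l in B) _.
  have : N <= 3.
    by rewrite (leq_trans _ B3) // -sum1_card leq_sum // => l _; case: odd.
  by case: N => [|[|[|[|]]]].
apply: leq_sum => l lB; rewrite (_ : f @^-1: _ = f' @^-1: [set l]) //.
apply/setP=> x; rewrite !inE /f'; case: ifP => // fB.
apply/eqP/eqP => e; first by rewrite -e fB in lB.
by rewrite -e bB in lB.
Qed.

(** The blocks are the fibres of a labelling [f], so gluing is relabelling. The identity labelling
    has [n] odd singletons; each further 3-cycle glues the blocks of its three points, at a cost of
    at most two odd blocks. *)
Lemma prod_3cycles_invariant n (s : 'S_n) k :
  is_prod_3cycles s k ->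
  exists2 f : 'I_n -> 'I_n, (forall x, f (s x) = f x) &
    n <= odd_fibres f + k.*2.
Proof.
case/is_prod_3cyclesP=> ts []; elim: ts k s => [|t ts IH] [|k] s //=.
  move=> _ _ ->; rewrite big_nil; exists id => [x|]; first by rewrite perm1.
  have -> : odd_fibres (id : 'I_n -> 'I_n) = \sum_(l < n) 1.
    apply: eq_bigr => l _; rewrite (_ : _ @^-1: _ = [set l]) ?cards1 //.
    by apply/setP=> x; rewrite !inE.
  by rewrite sum1_card card_ord addn0.
case=> sz /andP[t3 ts3] ->; rewrite big_cons.
have [f finv le_n] := IH _ _ sz ts3 erefl.
have /existsP[x /existsP[y /existsP[z]]] := t3.
case/and5P=> _ /eqP txy /eqP tyz /eqP tzx /forallP tfix.
pose B := [set f x; f y; f z].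
exists (fun v => if f v \in B then f x else f v) => [v|].
  rewrite permM finv.
  have [|/(implyP (tfix v))/eqP->//] := boolP (v \in [:: x; y; z]).
  by rewrite !inE => /or3P[]/eqP->; rewrite ?txy ?tyz ?tzx !eqxx ?orbT.
apply: (leq_trans le_n); rewrite doubleS -addn2 addnA addnAC leq_add2r.
apply: odd_fibres_merge; first by rewrite !inE eqxx.
by rewrite /B setUC cardsU1 (leq_add (leq_b1 _)) // cards2; case: eqP.
Qed.

(* When the cycle of [x0] is odd, this says that no other cycle is. *)
Definition even_away (T : finType) (s : {perm T}) (x0 : T) :=
  forall A : {set T}, (forall x, (s x \in A) = (x \in A)) -> x0 \notin A ->
  ~~ odd #|A|.

(** The fibres of an invariant labelling are stable under [s], so only the one containing [x0] can
    be odd, whence [n <= 1 + 2 * h s]. *)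
Lemma half_le_h n (s : 'S_n) x0 :
  s \in 'Alt_('I_n) -> even_away s x0 -> n.-1./2 <= h s.
Proof.
move=> sA s1.
have [f finv le_n] := prod_3cycles_invariant (is_prod_3cycles_h sA).
have : odd_fibres f <= 1.
  rewrite /odd_fibres (bigD1 (f x0)) //= big1 ?addn0 ?leq_b1 // => l lx0.
  apply/eqP; rewrite eqb0; apply: s1 => [x|]; first by rewrite !inE finv.
  by rewrite !inE eq_sym.
move=> o1; rewrite -[h s]doubleK half_leq // -subn1 leq_subLR.
by rewrite (leq_trans le_n) // leq_add2r.
Qed.

(** * From one coset to the maximum [h_max] *)

Lemma val_shiftX n j (x : 'I_n) : (shift n ^+ j) x = (x + j) %% n :> nat.
Proof.
rewrite permX; elim: j => [|j IH]; first by rewrite addn0 modn_small.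
by rewrite iterS permE /= IH -addn1 modnDml addn1 addnS.
Qed.

Lemma shift_even n : odd n -> shift n \in 'Alt_('I_n).
Proof.
(* An odd power of [shift n] is the identity, which forces an even sign. *)
move=> n_odd; rewrite Alt_even; have sn : shift n ^+ n = 1.
  apply/permP=> x; apply: val_inj.
  by rewrite /= val_shiftX modnDr modn_small ?perm1.
have oddX j : odd_perm (shift n ^+ j) = odd j && odd_perm (shift n).
  elim: j => [|j IH]; first by rewrite expg0 odd_perm1.
  by rewrite expgS odd_permM IH /=; case: odd_perm; case: odd.
by have := oddX n; rewrite sn odd_perm1 n_odd /= => <-.
Qed.

(** No even permutation exceeds [n./2], and the hypothesis on [pi] keeps its whole coset at or above
    that value. *)
Lemma h_max_eq_half n (pi : 'S_n) :
  odd n -> pi \in 'Alt_('I_n) ->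
  (forall j, exists x0, even_away (shift n ^+ j * pi) x0) ->
  h_max n = n./2.
Proof.
move=> n_odd piA pi1; apply/eqP; rewrite eqn_leq; apply/andP; split.
  apply/bigmax_leqP=> s sA; apply: leq_trans (h_le_half sA).
  rewrite /h_coset; elim/big_rec: _ => // t m _.
  exact: leq_trans (geq_minr _ _).
have le_h j : n./2 <= h (shift n ^+ j * pi).
  have [x0 s1] := pi1 j.
  have -> : n./2 = n.-1./2 by lia.
  by apply: half_le_h s1; rewrite groupM ?groupX ?shift_even.
apply: leq_trans (leq_bigmax_cond _ piA).
rewrite /h_coset; elim/big_rec: _ => [|s m].
  by have := le_h 0; rewrite expg0 mul1g.
by case/rcosetP=> c /cycleP[j ->] -> le_m; rewrite leq_min le_h.
Qed.

(** * Cycle decompositions given as lists *)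

Section Cycles.
Variables (T : finType) (s : {perm T}) (cs : seq (seq T)).
Hypotheses (cs_cycle : all (fcycle s) cs) (cs_nil : [::] \notin cs).
Hypothesis cs_enum : perm_eq (flatten cs) (enum T).

Lemma porbit_cycle c x : c \in cs -> x \in c -> porbit s x = [set y in c].
Proof.
move=> /(allP cs_cycle) cyc xc; apply/setP=> y.
rewrite inE -(fconnect_cycle cyc xc); apply/porbitP/idP.
  by case=> i ->; rewrite permX fconnect_iter.
by move/iter_findex => <-; exists (findex s x y); rewrite permX.
Qed.

Lemma card_porbits_cycles : #|porbits s| = size cs.
Proof.
have u : uniq (flatten cs) by rewrite (perm_uniq cs_enum) enum_uniq.
rewrite -(size_map (fun c => [set y in c]) cs) -(card_uniqP _).
  apply: eq_card => O; apply/imsetP/mapP.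
    case=> x _ ->; have : x \in flatten cs.
      by rewrite (perm_mem cs_enum) mem_enum.
    by case/flattenP=> c cc xc; exists c => //; apply: porbit_cycle.
  case=> [[|x c]] cc ->; first by case/negP: cs_nil.
  by exists x => //; rewrite (porbit_cycle cc) ?mem_head.
move: u cs_nil; elim: (cs) => //= c ds IH.
rewrite cat_uniq inE negb_or => /and3P[_ dis u] /andP[c0 nil].
rewrite IH // andbT; apply: contra dis => /mapP[d dd /setP e].
case: c c0 e => // x c _ /(_ x); rewrite !inE eqxx => /esym xd.
by apply/hasP; exists x; [apply/flattenP; exists d | rewrite mem_head].
Qed.

(** A stable set contains or misses each listed cycle as a whole. Taking [x0] in the only odd cycle,
    a stable set avoiding [x0] is a union of even cycles. *)
Lemma even_away_exists :
  count (fun c => odd (size c)) cs = 1%N -> exists x0, even_away s x0.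
Proof.
move=> c1; have /hasP[c cc oddc] : has (fun c => odd (size c)) cs.
  by rewrite has_count c1.
case: c => // x0 c in cc oddc *; exists x0 => A sA x0A.
have count_A d : d \in cs -> count (mem A) d = ((head x0 d \in A) * size d)%N.
  case: d => [|x d] dd; first by rewrite muln0.
  have eA y : y \in x :: d -> (y \in A) = (x \in A).
    move=> yd; have : y \in porbit s x.
      by rewrite (porbit_cycle dd) ?mem_head // inE.
    case/porbitP=> i ->; rewrite permX; elim: i => // i IH.
    by rewrite iterS sA.
  rewrite (eq_in_count (a2 := fun=> x \in A)) //.
  by case: (x \in A); rewrite ?count_predT ?count_pred0 ?mul1n.
have -> : #|A| = count (mem A) (flatten cs).
  by rewrite (seq.permP cs_enum) cardE enumT -size_filter.
have cs_rem := perm_to_rem cc.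
rewrite (seq.permP (perm_flatten cs_rem)) count_cat count_A //=.
rewrite (negPf x0A) mul0n add0n.
have : all (fun d => ~~ odd (size d)) (rem (x0 :: c) cs).
  rewrite all_predC has_count.
  move: c1; rewrite (seq.permP cs_rem) /= (_ : ~~ odd (size c)) // => -[].
  by rewrite add0n => ->.
have sub := mem_subseq (rem_subseq (x0 :: c) cs).
elim: (rem _ _) sub => //= d ds IH sub /andP[ed eds].
rewrite count_cat oddD (negPf (IH _ eds)) => [|e eE]; last first.
  by apply: sub; rewrite inE eE orbT.
by rewrite addbF count_A ?oddM ?(negPf ed) ?andbF // sub ?mem_head.
Qed.

End Cycles.

(** * Computing cycles on binary integers *)

Definition points (n : nat) : seq N := traject N.succ 0%num n.

Lemma points_enum n : points n = [seq N.of_nat (val i) | i <- enum 'I_n].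
Proof.
rewrite (map_comp N.of_nat) val_enum_ord /points -[0%num]/(N.of_nat 0).
by elim: n 0%N => //= n IH i; rewrite -IH Nat2N.inj_succ.
Qed.

Lemma pointsP n y : reflect (exists x : 'I_n, y = N.of_nat x) (y \in points n).
Proof.
rewrite points_enum; apply: (iffP mapP) => [[x _ ->]|[x ->]]; exists x => //.
exact: mem_enum.
Qed.

Lemma of_nat_ord_inj n : injective (fun x : 'I_n => N.of_nat x).
Proof. by move=> x y /Nat2N.inj /val_inj. Qed.

Lemma of_nat_modn m d : N.of_nat (m %% d) = (N.of_nat m mod N.of_nat d)%num.
Proof.
case: d => [|d]; first by rewrite modn0 N.mod_0_r.
apply: (N.mod_unique _ _ (N.of_nat (m %/ d.+1))).
  by have := ltn_pmod m (ltn0Sn d); lia.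
by have := divn_eq m d.+1; lia.
Qed.

Definition represents n (s : 'S_n) (f : N -> N) :=
  forall x : 'I_n, N.of_nat (s x) = f (N.of_nat x).

(** Sorting makes the test that [ys] rearranges the points cheap to evaluate. *)
Definition enumerates n (ys : seq N) := sort N.leb ys == points n.

Lemma enumerates_perm n ys : enumerates n ys -> perm_eq ys (points n).
Proof. by move/eqP <-; rewrite perm_sym perm_sort. Qed.

Lemma represents_exists n f :
  enumerates n (map f (points n)) -> exists s : 'S_n, represents s f.
Proof.
move/enumerates_perm => fE.
pose g (x : 'I_n) := f (N.of_nat x).
have gE x : exists y : 'I_n, g x = N.of_nat y.
  by apply/pointsP; rewrite -(perm_mem fE); apply/map_f/pointsP; exists x.
have g_inj : injective g.
  apply/injectiveP; rewrite /injectiveb /dinjectiveb.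
  have -> : [seq g x | x <- enum 'I_n] = map f (points n).
    by rewrite points_enum -map_comp.
  rewrite (perm_uniq fE) points_enum map_inj_uniq ?enum_uniq //.
  exact: of_nat_ord_inj.
have [h hE] := fin_all_exists gE.
have h_inj : injective h by move=> x y e; apply: g_inj; rewrite !hE e.
by exists (perm h_inj) => x; rewrite permE -hE.
Qed.

Fixpoint trace (f : N -> N) (fuel : nat) (x y : N) : seq N :=
  if fuel is k.+1 then
    y :: let z := f y in if N.eqb z x then [::] else trace f k x z
  else [::].

(** The walk from [x] stops at the first point not above [x]; when [f] permutes the points, [x] is
    least in its cycle exactly when that point is [x] itself. *)
Fixpoint is_leader (f : N -> N) (fuel : nat) (x y : N) : bool :=
  if fuel is k.+1 then
    let z := f y in if N.leb z x then N.eqb z x else is_leader f k x z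
  else false.

(* Each cycle is listed from its least point. Nothing is proved about this
   function: [is_cycle_decomposition] validates its output. *)
Definition cycles n f :=
  [seq trace f n x x | x <- points n & is_leader f n x x].

Definition is_cycle_decomposition n (f : N -> N) (cs : seq (seq N)) :=
  [&& [::] \notin cs, all (fcycle f) cs & enumerates n (flatten cs)].

Lemma cycle_decomposition_ord n (s : 'S_n) f cs :
  represents s f -> is_cycle_decomposition n f cs ->
  exists ds : seq (seq 'I_n),
    [/\ all (fcycle s) ds, [::] \notin ds, perm_eq (flatten ds) (enum 'I_n)
      & map size ds = map size cs].
Proof.
move=> sf /and3P[cs0 cyc /enumerates_perm csE].
(* [inord] below needs a nonempty ordinal type, so [n = 0] is treated apart. *)
case: n s sf csE => [|n] s sf csE.
  exists [::]; split => //; first by rewrite enum_ord0.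
  by case: cs cs0 cyc csE => // [[|x c] cs] //= _ _ /perm_size.
pose ord (y : N) : 'I_n.+1 := inord (N.to_nat y).
have ordK (x : 'I_n.+1) : ord (N.of_nat x) = x.
  by rewrite /ord Nat2N.id inord_val.
exists (map (map ord) cs); split.
- rewrite all_map; apply/allP => c cc /=.
  rewrite cycle_map.
  apply: (sub_in_cycle (P := mem (points n.+1))) (allP cyc _ cc) => [y z|].
    move=> /pointsP[x ->] /pointsP[x' ->] /= /eqP e.
    by rewrite !ordK; apply/eqP/of_nat_ord_inj; rewrite sf.
  apply/allP => y yc; suff: y \in points n.+1 by []; rewrite -(perm_mem csE).
  by apply/flattenP; exists c.
- by apply: contra cs0 => /mapP[[|x c]].
- rewrite -map_flatten (perm_trans (perm_map ord csE)) //.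
  by rewrite points_enum -map_comp (eq_map ordK) map_id.
by rewrite -map_comp; apply: eq_map => c; rewrite /= size_map.
Qed.

Definition has_one_odd_cycle n f :=
  let cs := cycles n f in
  is_cycle_decomposition n f cs && (count (fun c => odd (size c)) cs == 1%N).

Lemma represents_even_away n (s : 'S_n) f :
  represents s f -> has_one_odd_cycle n f -> exists x0, even_away s x0.
Proof.
move=> sf /andP[dec /eqP c1].
have [ds [cyc _ dE sz]] := cycle_decomposition_ord sf dec.
apply: (even_away_exists cyc dE).
have cntE T (es : seq (seq T)) :
    count (fun c => odd (size c)) es = count odd (map size es).
  by rewrite count_map.
by rewrite cntE sz -cntE.
Qed.

Lemma represents_even n (s : 'S_n) f :
  represents s f -> is_cycle_decomposition n f (cycles n f) ->
  odd_perm s = odd n (+) odd (size (cycles n f)).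
Proof.
(* By definition [odd_perm] adds the parities of the degree and of the number of orbits. *)
move=> sf /(cycle_decomposition_ord sf)[ds [cyc nil dE sz]].
rewrite /odd_perm card_ord (card_porbits_cycles cyc nil dE).
by rewrite -(size_map size) sz size_map.
Qed.

(** * Multiplier symmetry and witnesses *)

Lemma even_awayJ (T : finType) (s m : {perm T}) x0 :
  even_away s x0 -> even_away (s ^ m) (m x0).
Proof.
(* The preimage under [m] of a set stable under [s ^ m] is stable under [s] and has the same
   size. *)
move=> s1 A sA x0A; rewrite -(card_preimset A (@perm_inj _ m)).
apply: s1 => [x|]; last by rewrite inE.
by rewrite !inE -[in RHS]sA permJ.
Qed.

Definition scale (m g x : N) : N := (g * x mod m)%num.

(** This is $c^j\pi$ on residues when [F] represents $\pi$. *)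
Definition step (m : N) (F : N -> N) (j x : N) : N := F ((x + j) mod m)%num.

(* [F] is [pi], [g] generates a group of multipliers commuting with it, and
   the nonzero residues are the [g ^ i r] with [i < k] and [r \in reps]. *)
Definition is_witness (n : nat) (g : N) (k : nat) (reps : seq N) (F : N -> N) :=
  let m := N.of_nat n in
  [&& odd n, enumerates n (map F (points n)),
      enumerates n (map (scale m g) (points n)),
      all (fun x => F (scale m g x) == scale m g (F x)) (points n),
      enumerates n (0%num :: flatten [seq traject (scale m g) r k | r <- reps]),
      odd (size (cycles n (step m F 0%num)))
    & all (fun j => has_one_odd_cycle n (step m F j)) (0%num :: reps)].

Lemma witness_h_max n g k reps F :
  is_witness n g k reps F -> h_max n = (n - 1) %/ 2.
Proof.
rewrite /is_witness; set m := N.of_nat n.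
case/and5P=> n_odd /represents_exists[pi piF] /represents_exists[mu muE].
move=> /allP comm /and3P[/enumerates_perm repsE even_pi /allP good].
have modE y : (y mod m)%num \in points n.
  have y_lt : (N.to_nat y %% n < n)%N by rewrite ltn_mod; case: (n) n_odd.
  apply/pointsP; exists (Ordinal y_lt).
  by rewrite /= of_nat_modn N2Nat.id.
(* As [F] commutes with multiplication by [g], [F (g x + g j) = g F (x + j)]: conjugating by [mu]
   turns the shift by [g j] into the shift by [j]. *)
have stepJ (s : 'S_n) j : represents s (step m F (scale m g j)) ->
    represents (s ^ mu^-1) (step m F j).
  move=> sE x; have /pointsP[z zE] := modE (N.of_nat x + j)%num.
  suff -> : (s ^ mu^-1) x = pi z by rewrite piF -zE.
  rewrite -[x in LHS](permK mu) permJ; apply: (canLR (permK mu)).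
  apply: (@of_nat_ord_inj n); rewrite sE !muE piF -(eqP (comm _ _)); last first.
    by apply/pointsP; exists z.
  rewrite /step -zE /scale N.Div0.mul_mod_idemp_r -N.Div0.add_mod.
  by rewrite N.mul_add_distr_l.
(* The computed shifts [r] thus settle all the shifts [g ^ i r]. *)
have all_good i r (s : 'S_n) : r \in 0%num :: reps ->
    represents s (step m F (iter i (scale m g) r)) -> exists x0, even_away s x0.
  move=> rr; elim: i s => [|i IH] s sE.
    exact: represents_even_away sE (good _ rr).
  have [x0 /(@even_awayJ _ _ mu)] := IH _ (stepJ _ _ sE).
  by rewrite conjgKV; exists (mu x0).
have shiftE j : represents (shift n ^+ j * pi) (step m F (N.of_nat (j %% n))).
  move=> x; rewrite permM piF val_shiftX !of_nat_modn Nat2N.inj_add.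
  by rewrite /step N.Div0.add_mod_idemp_r.
have -> : (n - 1) %/ 2 = n./2 by rewrite divn2; lia.
apply: (@h_max_eq_half n pi) => // [|j].
  (* The shift [j = 0] also yields the sign of [pi]: the degree and the number of cycles are both
     odd. *)
  have pi0 : represents pi (step m F 0%num).
    move=> x; rewrite piF /step N.add_0_r N.mod_small //.
    by have := ltn_ord x; lia.
  have /andP[dec _] := good _ (mem_head _ _).
  by rewrite Alt_even (represents_even pi0 dec) n_odd even_pi.
have : N.of_nat (j %% n) \in points n by rewrite of_nat_modn modE.
rewrite -(perm_mem repsE) inE => /predU1P[j0|/flatten_mapP[r rr]].
  by apply: (all_good 0 0%num); rewrite ?mem_head // -j0.
case/trajectP=> i _ jE; apply: (all_good i r); last by rewrite -jE.
by rewrite inE rr orbT.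
Qed.

(** * The explicit witnesses *)

(** Keys are shifted by one because a [positive] is never 0. The default value 0 supplies [pi 0 = 0]
    in the cyclotomic case, where 0 has no entry. *)
Definition of_pairs (xys : seq (N * N)) : N -> N :=
  let t := foldr (fun xy => PositiveMap.add (N.succ_pos xy.1) xy.2)
                 (PositiveMap.empty N) xys in
  fun x => odflt 0%num (PositiveMap.find (N.succ_pos x) t).

(* [w ^ t] is sent to [a_(t mod e) w ^ t], where [e = size a]. *)
Definition cyclotomic (p w : N) (k : nat) (a : seq N) : N -> N :=
  let ws := traject (scale p w) 1%num (k * size a) in
  of_pairs (zip ws [seq scale p bx.1 bx.2 | bx <- zip (flatten (nseq k a)) ws]).

(** With [e = size a], the representatives are [1, w, ..., w ^ (e - 1)], and the multiplier [w ^ e]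
    is [w] times the last of them. *)
Definition cyclotomic_witness (p : nat) (w : N) (a : seq N) :=
  let m := N.of_nat p in
  let k := p.-1 %/ size a in
  let ws := traject (scale m w) 1%num (size a) in
  is_witness p (scale m w (last 1%num ws)) k ws (cyclotomic m w k a).

Lemma cyclotomic_h_max (p : nat) (w : N) (a : seq N) :
  cyclotomic_witness p w a -> h_max p = (p - 1) %/ 2.
Proof. exact: witness_h_max. Qed.

Definition table27 : seq N :=
  [:: 0; 14; 24; 11; 6; 8; 7; 17; 23; 15; 26; 2; 5; 9; 18; 22; 25; 1; 12; 4; 10;
      20; 19; 21; 16; 3; 13]%num.

Lemma h_max27 : h_max 27 = (27 - 1) %/ 2.
Proof.
(* The multiplier 26 is -1 modulo 27, of order 2; each pair of opposite nonzero residues has one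
   representative in 1, ..., 13. *)
apply: (@witness_h_max 27 26 2 (traject N.succ 1%num 13)
                       (of_pairs (zip (points 27) table27))).
by vm_compute.
Qed.

Local Close Scope group_scope.

Theorem theorem4p6 (n : nat)
  (hn : n \in [:: 19; 23; 27; 71; 103; 127; 271; 571; 631; 883; 991; 1039;
                  1171; 1279; 1579; 1723]) :
  h_max n = (n - 1) %/ 2.
Proof.
move: hn; rewrite !inE.
case/predU1P=> [->|].
  (* In each prime case the arguments are a primitive root modulo [n] and the multipliers [a_i];
     evaluating the witness test also confirms that the root is primitive. *)
  by apply: (@cyclotomic_h_max _ 2 [:: 3; 6; 18]%num); vm_compute.
case/predU1P=> [->|].
  apply: (@cyclotomic_h_max _ 5 [:: 2; 6; 4; 7; 8; 19; 15; 17; 9; 15; 15]%num).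
  by vm_compute.
case/predU1P=> [->|]; first exact: h_max27.
case/predU1P=> [->|].
  by apply: (@cyclotomic_h_max _ 7 [:: 46; 47; 23; 64; 55]%num); vm_compute.
case/predU1P=> [->|].
  by apply: (@cyclotomic_h_max _ 5 [:: 37; 7; 62]%num); vm_compute.
case/predU1P=> [->|].
  by apply: (@cyclotomic_h_max _ 3 [:: 89; 56; 18]%num); vm_compute.
case/predU1P=> [->|].
  by apply: (@cyclotomic_h_max _ 6 [:: 102; 103; 239]%num); vm_compute.
case/predU1P=> [->|].
  by apply: (@cyclotomic_h_max _ 3 [:: 100; 401; 60]%num); vm_compute.
case/predU1P=> [->|].
  by apply: (@cyclotomic_h_max _ 3 [:: 155; 363; 437]%num); vm_compute.
case/predU1P=> [->|].
  by apply: (@cyclotomic_h_max _ 2 [:: 522; 460; 837]%num); vm_compute.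
case/predU1P=> [->|].
  by apply: (@cyclotomic_h_max _ 6 [:: 705; 818; 103]%num); vm_compute.
case/predU1P=> [->|].
  by apply: (@cyclotomic_h_max _ 3 [:: 124; 166; 926]%num); vm_compute.
case/predU1P=> [->|].
  by apply: (@cyclotomic_h_max _ 2 [:: 59; 519; 730]%num); vm_compute.
case/predU1P=> [->|].
  by apply: (@cyclotomic_h_max _ 3 [:: 149; 143; 520]%num); vm_compute.
case/predU1P=> [->|].
  by apply: (@cyclotomic_h_max _ 3 [:: 191; 1257; 770]%num); vm_compute.
move/eqP->.
by apply: (@cyclotomic_h_max _ 3 [:: 1078; 1672; 990]%num); vm_compute.
Qed.
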